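(* As formal power series in $z$, $$\sum_{k=3}^{\infty}d_2(2^k-3)\,z^k=\frac{z^3}{1-z}+\sum_{l=3}^{\infty}\frac{(1-z)^2z^l}{1-2z+z^{l-1}-z^l+z^{l+2}}=2z^3+2z^4+2z^5+4z^6+6z^7+10z^8+\cdots.$$
   Context: Nonnegative integers are written in base $2$ with digits $0,1$: $n=n_{k-1}\ldots n_0|_2$ denotes $\sum_i n_i2^i$. The base $2$ dismal product of $m=m_{k-1}\ldots m_0|_2$ and $n=n_{l-1}\ldots n_0|_2$ is the number $m\otimes_2 n$ whose $i$-th binary digit, $0\le i\le k+l-2$, is $\max\{\min\{m_j,n_{i-j}\}:0\le j\le k-1,\ 0\le i-j\le l-1\}$ (i.e. OR of ANDs, no carries). A number $p$ is a base $2$ dismal divisor of $n$ if $p\otimes_2 q=n$ for some nonnegative integer $q$; $d_2(n)$ is the number of base $2$ dismal divisors of $n$ (finite for $n\ge1$). *)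

(* Defs.v *)
From HB Require Import structures.
From mathcomp Require Import all_boot all_order all_algebra.
From mathcomp Require Import finmap.
From mathcomp Require Import boolp classical_sets functions cardinality.

Set Implicit Arguments.
Unset Strict Implicit.
Unset Printing Implicit Defensive.

Import Order.TTheory GRing.Theory Num.Theory.

Definition bit (n i : nat) : nat := (n %/ 2 ^ i) %% 2.

(* As [trunc_log 2 0 = 0], the number 0 is written with the one digit 0. *)
Definition bit_length (n : nat) : nat := (trunc_log 2 n).+1.

Definition dismal_digit (m n i : nat) : nat :=
  \max_(j < bit_length m | (j <= i) && (i - j < bit_length n))
     minn (bit m j) (bit n (i - j)).

Definition dismal_mul (m n : nat) : nat :=
  \sum_(i < (bit_length m + bit_length n).-1) dismal_digit m n i * 2 ^ i.

Definition dismal_dvd (p n : nat) : Prop := exists q : nat, dismal_mul p q = n.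

Definition dismal_divisors (n : nat) : set nat :=
  [set p | dismal_dvd p n]%classic.

(* [fset_set] returns the empty set on infinite sets; this only happens for
   [n = 0], see [finite_dismal_divisors]. *)
Definition d2 (n : nat) : nat := #|` fset_set (dismal_divisors n)|%fset.

Lemma bit_top (n : nat) : 0 < n -> bit n (trunc_log 2 n) = 1.
Proof.
move=> n0; have /andP[h1 h2] := trunc_log_bounds (isT : 1 < 2) n0.
suff e : n %/ 2 ^ trunc_log 2 n = 1 by rewrite /bit e.
apply/eqP; rewrite eqn_leq -ltnS ltn_divLR ?expn_gt0// -expnS h2 /=.
by rewrite divn_gt0 ?expn_gt0.
Qed.

Lemma dismal_mulr0 (p : nat) : dismal_mul p 0 = 0.
Proof.
rewrite /dismal_mul big1 // => i _; rewrite /dismal_digit big1 // => j _.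
by rewrite /bit div0n mod0n minn0.
Qed.

Lemma finite_dismal_divisors (n : nat) :
  0 < n -> finite_set (dismal_divisors n).
Proof.
move=> n0; apply: (@sub_finite_set _ _ [set` [fset p | p in iota 0 (2 * n)]%fset]);
  last exact: finite_fset.
move=> p [q pq] /=; rewrite in_fset /= mem_iota /= add0n.
case: (posnP p) => [->|p0]; first by rewrite muln_gt0.
case: (posnP q) => [q0|q0]; first by rewrite -pq q0 dismal_mulr0 in n0.
have /andP[_ hp] := trunc_log_bounds (isT : 1 < 2) p0.
apply: (leq_trans hp); rewrite expnS leq_pmul2l // -pq /dismal_mul.
have lt : trunc_log 2 p + trunc_log 2 q < (bit_length p + bit_length q).-1.
  by rewrite /bit_length addSn addnS.
rewrite (bigD1 (Ordinal lt)) //=; apply: leq_trans (leq_addr _ _).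
suff dg : 0 < dismal_digit p q (trunc_log 2 p + trunc_log 2 q).
  apply: leq_trans (leq_pmull _ dg).
  by rewrite leq_exp2l // leq_addr.
rewrite /dismal_digit (bigD1 (Ordinal (ltnSn (trunc_log 2 p)))) /=; last first.
  by rewrite leq_addr addKn ltnSn.
by rewrite addKn !bit_top // leq_max.
Qed.

Local Open Scope ring_scope.

Record fps (R : Type) := Fps { fps_coef : nat -> R }.

Notation "{ 'fps' R }" := (fps R) (at level 0, format "{ 'fps'  R }").
Notation "f `[ n ]" := (fps_coef f n)
  (at level 2, left associativity, format "f `[ n ]") : ring_scope.

Lemma fpsP (R : Type) (f g : {fps R}) : fps_coef f =1 fps_coef g <-> f = g.
Proof. by split=> [|->//]; case: f g => [f] [g] /= /funext ->. Qed.

HB.instance Definition _ (R : Type) := gen_eqMixin {fps R}.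
HB.instance Definition _ (R : Type) := gen_choiceMixin {fps R}.

Section FpsZmod.
Variable R : zmodType.
Implicit Types f g : {fps R}.

Definition fps_zero : {fps R} := Fps (fun=> 0).
Definition fps_opp f : {fps R} := Fps (fun n => - f`[n]).
Definition fps_add f g : {fps R} := Fps (fun n => f`[n] + g`[n]).

Fact fps_addA : associative fps_add.
Proof. by move=> f g h; apply/fpsP => n /=; rewrite addrA. Qed.
Fact fps_addC : commutative fps_add.
Proof. by move=> f g; apply/fpsP => n /=; rewrite addrC. Qed.
Fact fps_add0 : left_id fps_zero fps_add.
Proof. by move=> f; apply/fpsP => n /=; rewrite add0r. Qed.
Fact fps_addN : left_inverse fps_zero fps_opp fps_add.
Proof. by move=> f; apply/fpsP => n /=; rewrite addNr. Qed.

HB.instance Definition _ := GRing.isZmodule.Build {fps R}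
  fps_addA fps_addC fps_add0 fps_addN.

Lemma fps_coef0 n : (0 : {fps R})`[n] = 0. Proof. by []. Qed.
Lemma fps_coefN f n : (- f)`[n] = - f`[n]. Proof. by []. Qed.
Lemma fps_coefD f g n : (f + g)`[n] = f`[n] + g`[n]. Proof. by []. Qed.
End FpsZmod.

Section FpsRing.
Variable R : comNzRingType.
Implicit Types f g h : {fps R}.

Definition fps_one : {fps R} := Fps (fun n => (n == 0)%N%:R).
Definition fps_mul f g : {fps R} :=
  Fps (fun n => \sum_(i < n.+1) f`[i] * g`[n - i]).

Let trunc N f : {poly R} := \poly_(i < N) f`[i].

Let coef_trunc_mul N f g n : (n < N)%N ->
  (trunc N f * trunc N g)`_n = (fps_mul f g)`[n].
Proof.
move=> nN; rewrite coefM /=; apply: eq_bigr => i _; rewrite !coef_poly.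
by rewrite (leq_ltn_trans _ nN) ?(leq_ltn_trans _ nN) ?leq_subr // -ltnS.
Qed.

Fact fps_mulC : commutative fps_mul.
Proof.
move=> f g; apply/fpsP => n.
by rewrite -!(@coef_trunc_mul n.+1) // mulrC.
Qed.

Fact fps_mulA : associative fps_mul.
Proof.
move=> f g h; apply/fpsP => n.
have -> : (fps_mul f (fps_mul g h))`[n] =
    (trunc n.+1 f * (trunc n.+1 g * trunc n.+1 h))`_n.
  rewrite coefM /=; apply: eq_bigr => i _; rewrite coef_trunc_mul ?coef_poly.
    by rewrite ltn_ord.
  by rewrite ltnS leq_subr.
have -> : (fps_mul (fps_mul f g) h)`[n] =
    (trunc n.+1 f * trunc n.+1 g * trunc n.+1 h)`_n.
  rewrite coefM /=; apply: eq_bigr => i _; rewrite coef_trunc_mul //.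
  by rewrite coef_poly ltnS leq_subr.
by rewrite mulrA.
Qed.

Fact fps_mul1 : left_id fps_one fps_mul.
Proof.
move=> f; apply/fpsP => n /=; rewrite big_ord_recl /= mul1r subn0 big1 ?addr0//.
by move=> i _; rewrite mul0r.
Qed.

Fact fps_mulDl : left_distributive fps_mul (@fps_add R).
Proof.
move=> f g h; apply/fpsP => n /=; rewrite -big_split /=.
by apply: eq_bigr => i _; rewrite mulrDl.
Qed.

Fact fps_one_neq0 : fps_one != 0 :> {fps R}.
Proof.
by apply/eqP => /fpsP /(_ 0%N) /= /eqP; rewrite oner_eq0.
Qed.

HB.instance Definition _ := GRing.Zmodule_isComNzRing.Build {fps R}
  fps_mulA fps_mulC fps_mul1 fps_mulDl fps_one_neq0.

Definition fpsX : {fps R} := Fps (fun n => (n == 1)%N%:R).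

Lemma fps_coef1 n : (1 : {fps R})`[n] = (n == 0)%N%:R. Proof. by []. Qed.
Lemma fps_coefM f g n : (f * g)`[n] = \sum_(i < n.+1) f`[i] * g`[n - i].
Proof. by []. Qed.
End FpsRing.

Section FpsUnitRing.
Variable R : comUnitRingType.
Implicit Types f g : {fps R}.

Definition fps_unit : {pred {fps R}} := fun f => f`[0] \is a GRing.unit.

(* The coefficients 0, ..., n of the inverse of f, in decreasing order. *)
Fixpoint fps_inv_rev f (n : nat) : seq R :=
  if n is m.+1 then
    let s := fps_inv_rev f m in
    - f`[0]^-1 * (\sum_(i < m.+1) f`[i.+1] * s`_i) :: s
  else [:: f`[0]^-1].

Definition fps_inv f : {fps R} :=
  if f \in fps_unit then Fps (fun n => head 0 (fps_inv_rev f n)) else f.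

Let nth_inv_rev f n i : (i <= n)%N ->
  (fps_inv_rev f n)`_i = head 0 (fps_inv_rev f (n - i)).
Proof.
elim: n i => [|n IHn] [|i] //= hi; by rewrite IHn.
Qed.

Fact fps_mulVx : {in fps_unit, left_inverse 1 fps_inv *%R}.
Proof.
move=> f uf; rewrite mulrC /fps_inv uf; apply/fpsP => -[|n].
  by rewrite fps_coefM big_ord1 /= mulrV.
rewrite fps_coefM big_ord_recl /= mulrA mulrN mulrV // mulN1r.
apply/eqP; rewrite addrC subr_eq0; apply/eqP; apply: eq_bigr => i _.
by rewrite nth_inv_rev // -ltnS.
Qed.

Fact fps_unitPl f g : g * f = 1 -> fps_unit f.
Proof.
move=> /fpsP /(_ 0%N); rewrite fps_coefM big_ord1 /= => e.
by apply/unitrPr; exists g`[0]; rewrite mulrC.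
Qed.

Fact fps_inv_out : {in [predC fps_unit], fps_inv =1 id}.
Proof. by move=> f; rewrite inE /fps_inv /= => /negbTE ->. Qed.

HB.instance Definition _ := GRing.ComNzRing_hasMulInverse.Build {fps R}
  fps_mulVx fps_unitPl fps_inv_out.

Lemma fps_unitE f : (f \is a GRing.unit) = (f`[0] \is a GRing.unit).
Proof. by []. Qed.
End FpsUnitRing.

Section FpsSum.
Variable R : zmodType.
Implicit Types (F : nat -> {fps R}) (S : {fps R}) (m : nat).

(* Convergence of the partial sums in the coefficientwise (z-adic) topology:
   each coefficient is eventually constant. *)
Definition fps_sums_to m F S : Prop :=
  forall n : nat, exists N : nat, forall M : nat, (N <= M)%N ->
    (\sum_(m <= i < M) F i)`[n] = S`[n].

Definition fps_summable m F : Prop := exists S, fps_sums_to m F S.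

Definition fps_sum m F : {fps R} := xget 0 [set S | fps_sums_to m F S]%classic.

Lemma fps_sums_to_unique m F S T :
  fps_sums_to m F S -> fps_sums_to m F T -> S = T.
Proof.
move=> hS hT; apply/fpsP => n; have [[N1 h1] [N2 h2]] := (hS n, hT n).
by rewrite -(h1 (maxn N1 N2)) ?leq_maxl // h2 ?leq_maxr.
Qed.

Lemma fps_sumE m F S : fps_sums_to m F S -> fps_sum m F = S.
Proof. by move=> h; apply: xget_unique => // T /fps_sums_to_unique; apply. Qed.
End FpsSum.

Notation "\fps_sum_ ( m <= i ) F" := (fps_sum m (fun i : nat => F))
  (at level 41, F at level 41, m at level 50, i name,
   format "'[' \fps_sum_ ( m  <=  i ) '/  '  F ']'") : ring_scope.

(* Main.v *)
Require Import Defs.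
From mathcomp Require Import all_boot all_order all_algebra.
From mathcomp Require Import finmap boolp classical_sets functions cardinality.
From mathcomp Require Import zify ring.

(** A dismal product is a sumset: identifying a number with the set of
    positions of its binary digits 1, [p] divides [2 ^ k - 3] when
    [P + Q = {0, 2, 3, ..., k - 1}] for some [Q]. Both [P] and [Q] then contain
    0 and avoid 1. If the top digit of [p] is at [t], that of the cofactor is at
    [m = k - 1 - t], and the best cofactor is [Q = {0, 2, ..., m}]
    ([dvd_m3P]). For [m = 0] this leaves one divisor, [2 ^ k - 3] itself, which
    for varying [k] gives [z ^+ 3 / (1 - z)]; for [m = 1] there is none.

    For [m >= 2], [p] is a divisor exactly when its word of digits, lowest
    first, is [1], or begins with [10], ends with [1], and has the following property:
    each 0 from position 2 on, including the one that follows the last digit,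
    has a 1 at a distance between 2 and [m] before it. In terms of runs: all runs
    of zeros have length at most [m], and a run of length [m - 1] or [m] is
    followed by at least two ones. A finite automaton tests this property
    ([accepts], [acceptsP]), so the series of the accepted words satisfy linear
    equations ([accept_fpsE]). Their solution is the rational function of the
    theorem for [l = m + 1] ([term_fps_mul]): if [B] is the series of the
    admissible blocks of zeros followed by ones, the words are counted by
    [z / (1 - B)], where
    [(1 - z) ^+ 2 * (1 - B) = 1 - 2 z + z ^+ m - z ^+ (m + 1) + z ^+ (m + 3)].

    It remains to sort the divisors by the position of their top digit
    ([d2_m3]), and to do the same in the sum over [l] ([rat_sum_coef]). *)

Set Implicit Arguments.
Unset Strict Implicit.
Unset Printing Implicit Defensive.

Import GRing.Theory.

(** * Binary digits and dismal products *)

Definition tbit (n i : nat) : bool := odd (n %/ 2 ^ i).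

Lemma bitE n i : bit n i = tbit n i.
Proof. by rewrite /bit modn2. Qed.

Lemma tbit0 (b : bool) n : tbit (b + 2 * n) 0 = b.
Proof. by rewrite /tbit divn1 oddD oddM addbF oddb. Qed.

Lemma tbitS (b : bool) n i : tbit (b + 2 * n) i.+1 = tbit n i.
Proof.
rewrite /tbit expnS divnMA; congr (odd (_ %/ _)).
by rewrite addnC mulnC divnMDl // divn_small ?addn0 //; case: b.
Qed.

Lemma bit_decomp n : n = odd n + 2 * n./2.
Proof. by rewrite mul2n odd_double_half. Qed.

Lemma tbit_nat0 i : tbit 0 i = false.
Proof. by rewrite /tbit div0n. Qed.

Lemma tbit_one i : tbit 1 i = (i == 0).
Proof.
have e : 1 = true + 2 * 0 by [].
by rewrite e; case: i => [|i]; rewrite ?tbit0 // tbitS tbit_nat0.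
Qed.

Lemma tbit_inj m n : tbit m =1 tbit n -> m = n.
Proof.
elim/ltn_ind: m n => m IH n E; rewrite (bit_decomp m) (bit_decomp n).
have E0 : odd m = odd n.
  by move: (E 0); rewrite {1}(bit_decomp m) {1}(bit_decomp n) !tbit0.
have ES : tbit m./2 =1 tbit n./2.
  move=> i; move: (E i.+1).
  by rewrite {1}(bit_decomp m) {1}(bit_decomp n) !tbitS.
have [m0|m0] := posnP m; last by rewrite E0 (IH _ _ _ ES) //; lia.
subst m; rewrite E0; have [n0|n0] := posnP n; first by rewrite n0.
have nz : tbit n (trunc_log 2 n) by have := bit_top n0; rewrite bitE; case: tbit.
by rewrite -E tbit_nat0 in nz.
Qed.

Lemma tbit_small n i k : n < 2 ^ k -> tbit n i -> i < k.
Proof.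
move=> nk; apply: contraTT; rewrite -leqNgt => ki.
by rewrite /tbit divn_small // (leq_trans nk) // leq_exp2l.
Qed.

Lemma tbit_top n t : 2 ^ t <= n < 2 ^ t.+1 -> tbit n t.
Proof.
move=> nt; have <- : trunc_log 2 n = t by apply: trunc_log_eq.
have n0 : 0 < n by case/andP: nt => h _; apply: leq_trans h; rewrite expn_gt0.
by have := bit_top n0; rewrite bitE; case: tbit.
Qed.

Lemma tbit_bit_length n i : tbit n i -> i < bit_length n.
Proof.
have [->|n0] := posnP n; first by rewrite tbit_nat0.
apply: tbit_small; by have /andP[] := trunc_log_bounds (isT : 1 < 2) n0.
Qed.

(** Digits of a sum of powers of 2 with coefficients 0 and 1 are these
    coefficients: there are no carries. *)
Lemma tbit_sum (c : nat -> bool) L i :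
  tbit (\sum_(j < L) c j * 2 ^ j) i = (i < L) && c i.
Proof.
elim: L c i => [|L IH] c i; first by rewrite big_ord0 tbit_nat0.
have -> : \sum_(j < L.+1) c j * 2 ^ j = c 0 + 2 * \sum_(j < L) c j.+1 * 2 ^ j.
  rewrite big_ord_recl /= muln1 big_distrr /=; congr (_ + _).
  by apply: eq_bigr => j _; rewrite /bump /= add1n expnS mulnCA.
by case: i => [|i]; rewrite ?tbit0 // tbitS (IH (fun j => c j.+1)).
Qed.

(** The digit set of a dismal product is the sumset of the digit sets of its
    factors; the index bounds in the definition of the product are harmless
    because digits beyond the length of a number vanish. *)
Lemma dismal_mulP p q i :
  reflect (exists2 j, j <= i & tbit p j && tbit q (i - j))
          (tbit (dismal_mul p q) i).
Proof.
pose c i := [exists j : 'I_i.+1, tbit p j && tbit q (i - j)].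
have cP r : reflect (exists2 j, j <= r & tbit p j && tbit q (r - j)) (c r).
  apply: (iffP existsP) => [[j pq]|[j jr pq]].
    by exists j; first exact: (ltn_ord j).
  by exists (Ordinal (jr : j < r.+1)).
have dE r : dismal_digit p q r = c r.
  apply/eqP; rewrite eqn_leq; apply/andP; split.
    apply/bigmax_leqP => j /andP[jr _]; rewrite !bitE.
    have -> : minn (tbit p j) (tbit q (r - j)) = tbit p j && tbit q (r - j).
      by case: (tbit p j); case: (tbit q _).
    case pq: (tbit p j && _) => //=.
    by suff -> : c r by []; apply/cP; exists (nat_of_ord j).
  case: cP => // -[j jr /andP[pj qj]].
  rewrite /dismal_digit (bigD1 (Ordinal (tbit_bit_length pj))) /=.
    by rewrite !bitE pj qj leq_max.
  by rewrite jr tbit_bit_length.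
rewrite /dismal_mul; under eq_bigr do rewrite dE.
rewrite tbit_sum; apply: (iffP andP) => [[_ /cP]//|].
move=> ex; split; last exact/cP.
case: ex => j ji /andP[/tbit_bit_length hp /tbit_bit_length hq]; lia.
Qed.

Lemma dismal_dvdP p n :
  dismal_dvd p n <-> exists q, forall i,
    tbit n i <-> exists2 j, j <= i & tbit p j && tbit q (i - j).
Proof.
split=> -[q pq]; exists q.
  by move=> i; rewrite -pq; split=> /dismal_mulP.
by apply: tbit_inj => i; apply/dismal_mulP/idP => /pq.
Qed.

(** * Divisors of [2 ^ k - 3] as a covering problem *)

Lemma tbit_ones a i : tbit (2 ^ a - 1) i = (i < a).
Proof.
elim: a i => [|a IH] i; first by rewrite tbit_nat0.
have -> : 2 ^ a.+1 - 1 = true + 2 * (2 ^ a - 1).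
  by have := expn_gt0 2 a; rewrite expnS; lia.
by case: i => [|i]; rewrite ?tbit0 ?tbitS ?IH.
Qed.

Lemma tbit_m3 k i : 2 < k -> tbit (2 ^ k - 3) i = (i == 0) || (1 < i < k).
Proof.
case: k => [|[|k]] // k0.
have -> : 2 ^ k.+2 - 3 = true + 2 * (false + 2 * (2 ^ k - 1)).
  by have := expn_gt0 2 k; rewrite !expnS; lia.
by case: i => [|[|i]]; rewrite ?tbit0 ?tbitS ?tbit0 ?tbit_ones.
Qed.

(** [window m p i] says that digit [i] of the product of [p] with
    [2 ^ m.+1 - 3] is produced by a digit of the second factor other than its
    lowest one; these digits occupy the positions from 2 to [m]. *)
Definition window (m : nat) (p i : nat) : Prop :=
  exists j, [/\ j.+2 <= i, i <= j + m & tbit p j].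

(** If the top digit of [p] is at [t] then that of a cofactor is at
    [m = k.-1 - t], and digit 1 of the cofactor vanishes, since [p] has digit 0
    and the product lacks digit 1. So the digit set of the cofactor is
    contained in [{0, 2, ..., m}]; as enlarging it there never creates digit 1
    of the product, the number [2 ^ m.+1 - 3] is a cofactor as soon as one
    exists. Above [t.+1] the top digit of [p] alone covers everything. For
    [m = 0] the cofactor is 1, and for [m = 1] there is none. *)
Lemma dvd_m3P k t p : 2 < k -> t < k -> 2 ^ t <= p < 2 ^ t.+1 ->
  let m := k.-1 - t in
  dismal_dvd p (2 ^ k - 3) <->
    [\/ m = 0 /\ p = 2 ^ k - 3
      | [/\ 1 < m, tbit p 0, ~~ tbit p 1 &
          forall i, 1 < i <= t.+1 -> tbit p i \/ window m p i]].
Proof.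
move=> k2 tk pt m; have pT := tbit_top pt.
have ple j : tbit p j -> j <= t.
  by rewrite -ltnS; apply: tbit_small; case/andP: pt.
rewrite dismal_dvdP; split=> [[q pq]|].
  have N j i : tbit p j -> tbit q i -> (i + j == 0) || (1 < i + j < k).
    move=> pj qi; rewrite -tbit_m3 //; apply/pq.
    by exists j; rewrite ?leq_addl // addnK pj qi.
  have [p0 q0] : tbit p 0 /\ tbit q 0.
    have /pq[j] : tbit (2 ^ k - 3) 0 by rewrite tbit_m3.
    by rewrite leqn0 => /eqP -> /andP[].
  have p1 : ~~ tbit p 1 by apply/negP => /N /(_ q0).
  have q1 : ~~ tbit q 1 by apply/negP => /(N _ _ p0).
  have qle i : tbit q i -> i <= m by move=> /(N _ _ pT); rewrite /m; lia.
  (* The top digit of the product arises only from the two top digits. *)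
  have qm : tbit q m.
    have /pq[j jk /andP[pj qj]] : tbit (2 ^ k - 3) k.-1.
      by rewrite tbit_m3 //; lia.
    have := ple _ pj; have := qle _ qj; rewrite /m => h1 h2.
    by have -> : k.-1 - t = k.-1 - j by lia.
  have [m0|m0] := posnP m.
    left; split=> //; apply: tbit_inj => i; apply/idP/idP => [pi|/pq[j ji]].
      by apply/pq; exists i; rewrite // subnn pi q0.
    move=> /andP[pj /qle]; rewrite m0 => h.
    by have -> : i = j by lia.
  have m1 : m != 1 by apply: contraNneq q1 => <-.
  right; split=> // [|i it]; first lia.
  have /pq[j ji /andP[pj qj]] : tbit (2 ^ k - 3) i by rewrite tbit_m3 //; lia.
  have := qle _ qj => qm'.
  have ij1 : i - j != 1 by apply: contraNneq q1 => <-.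
  have [<-|ij] := eqVneq j i; first by left.
  by right; exists j; split=> //; lia.
case=> [[_ ->]|[m1 p0 p1 pw]].
  exists 1 => i; split=> [pi|[j ji /andP[pj]]].
    by exists i; rewrite // subnn pi.
  rewrite tbit_one => ij; by have -> : i = j by lia.
have m2 : 2 < m.+1 by [].
exists (2 ^ m.+1 - 3) => i; rewrite tbit_m3 //; split=> [|[j ji]]; last first.
  rewrite tbit_m3 // => /andP[pj].
  have := ple _ pj; have j1 : j != 1 by apply: contraNneq p1 => <-.
  by rewrite /m; lia.
have [->|i0] := posnP i; first by exists 0; rewrite ?p0 ?tbit_m3.
move=> /= /andP[i1 ik].
have [it|it] := leqP i t.+1.
  have [pi|[j [ji ij pj]]] := pw i (introT andP (conj i1 it)).
    by exists i; rewrite // subnn pi tbit_m3.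
  by exists j; [lia|rewrite pj tbit_m3 //; lia].
by exists t; [lia|rewrite pT tbit_m3 //; lia].
Qed.

(** * An automaton for the covering condition *)

(** An automaton reading the [n] lowest digits of [q], lowest first. Its state
    before position [i] consists of the digit [b] at [i.-1] and of the distance
    [d] from [i] to the latest 1 among the positions up to [i - 2]; a 0 may be
    read only if this distance is at most [m]. The final test is that the last
    digit is a 1 and that a further 0 could be read: this is the condition at
    position [t.+1] in [dvd_m3P]. *)
Fixpoint accepts (m : nat) (b : bool) (d n q : nat) : bool :=
  if n is n'.+1 then
    (odd q || (d <= m)) && accepts m (odd q) (if b then 2 else d.+1) n' q./2
  else b && (d <= m).

(** Only the latest 1 counts: the ones further away are in the window at [i]
    only if that one is, hence one number [d] records all that the future of a
    word needs to know about the ones already read. *)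
Lemma leq_window m p i d :
  2 <= d <= i -> tbit p (i - d) ->
  (forall e, 2 <= e < d -> ~~ tbit p (i - e)) ->
  d <= m <-> window m p i.
Proof.
case/andP=> d2 di pd pe; split=> [dm|[j [ji ij pj]]].
  by exists (i - d); split=> //; lia.
rewrite leqNgt; apply/negP => md; have : 2 <= i - j < d by lia.
by move/pe; rewrite subKn ?pj //; lia.
Qed.

(** The hypotheses say that [b] and [d] are the state after the first [i]
    digits of [p]. *)
Lemma acceptsP m p n i b d :
  2 <= d <= i -> b = tbit p i.-1 -> tbit p (i - d) ->
  (forall e, 2 <= e < d -> ~~ tbit p (i - e)) ->
  accepts m b d n (p %/ 2 ^ i) <->
  [/\ tbit p (i + n).-1, window m p (i + n)
    & forall j, i <= j < i + n -> tbit p j \/ window m p j].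
Proof.
elim: n i b d => [|n IH] i b d /andP[d2 di] bE pd pe.
  have wE := leq_window m (introT andP (conj d2 di)) pd pe.
  rewrite /= addn0 -bE; split=> [/andP[-> /wE]|[-> /wE ->]] //.
  by split=> // j; lia.
have wE := leq_window m (introT andP (conj d2 di)) pd pe.
have halfE : (p %/ 2 ^ i)./2 = p %/ 2 ^ i.+1.
  by rewrite -divn2 -divnMA expnSr.
rewrite /= halfE -/(tbit p i).
have {}IH := IH i.+1 (tbit p i) (if b then 2 else d.+1).
rewrite addSn -addnS in IH.
have -> : forall P : bool,
  P && accepts m (tbit p i) (if b then 2 else d.+1) n (p %/ 2 ^ i.+1) <->
  P /\ [/\ tbit p (i + n.+1).-1, window m p (i + n.+1)
    & forall j, i.+1 <= j < i + n.+1 -> tbit p j \/ window m p j].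
  move=> P; rewrite -IH; first by split=> /andP.
  - by case: b {bE IH} => //; lia.
  - by [].
  - by case: b bE {IH} => [bE|_]; [rewrite subSS subn1 -bE | rewrite subSS].
  move=> e; case: b bE {IH} => [bE|bE]; first lia.
  have [->|e2] := eqVneq e 2; first by rewrite subSS subn1 -bE.
  move=> he; have -> : i.+1 - e = i - e.-1 by lia.
  by apply: pe; lia.
split=> [[h [h1 h2 h3]]|[h1 h2 h3]]; split=> //.
- move=> j ij; have [<-|ne] := eqVneq i j; last by apply: h3; lia.
  by case/orP: h => [|/wE]; [left|right].
- have [-> //|/wE ->] := h3 i ltac:(lia); by rewrite orbT.
- by split=> // j hj; apply: h3; lia.
Qed.

(** Splitting by the first digit makes the number of accepted words computable
    by recursion on their length; see [accept_countE]. *)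
Fixpoint accept_count (m : nat) (b : bool) (d n : nat) : nat :=
  if n is n'.+1 then
    let d' := if b then 2 else d.+1 in
    accept_count m true d' n' + (d <= m) * accept_count m false d' n'
  else b && (d <= m).

Lemma sum_parity (f : nat -> nat) n :
  \sum_(0 <= q < n.*2) f q = \sum_(0 <= q < n) (f q.*2.+1 + f q.*2).
Proof.
elim: n => [|n IH]; first by rewrite !big_nil.
by rewrite doubleS !big_nat_recr //= IH -addnA (addnC (f n.*2)).
Qed.

Lemma accept_countE m b d n :
  \sum_(0 <= q < 2 ^ n) accepts m b d n q = accept_count m b d n.
Proof.
elim: n b d => [|n IH] b d; first by rewrite big_nat1.
rewrite expnS mul2n sum_parity big_split /= -!IH big_distrr /=.
congr (_ + _); apply: eq_bigr => q _.
  by rewrite /= odd_double uphalf_double.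
by rewrite odd_double doubleK /= mulnb.
Qed.

(** The last digit of an accepted word is a 1, so its value has no leading
    zeros. *)
Lemma accepts_small m b d n q : q < 2 ^ n -> accepts m b d n.+1 q = false.
Proof.
elim: n b d q => [|n IH] b d q.
  by case: q => //= _; rewrite andbF.
rewrite expnS mul2n => qn; rewrite [LHS]/= -/(accepts _ _ _ n.+1 _) IH ?andbF //.
by rewrite -divn2 ltn_divLR // muln2.
Qed.

Lemma sum_quarter (f : nat -> nat) n :
  (forall p, p %% 4 != 1 -> f p = 0) ->
  \sum_(0 <= p < 4 * n) f p = \sum_(0 <= q < n) f (4 * q + 1).
Proof.
move=> f0; elim: n => [|n IH]; first by rewrite !big_nil.
have -> : 4 * n.+1 = (4 * n).+4 by lia.
rewrite !big_nat_recr //= IH.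
have -> : 4 * n + 1 = (4 * n).+1 by lia.
rewrite [f (4 * n)]f0 1?[f (4 * n).+2]f0 1?[f (4 * n).+3]f0 ?addn0 //; lia.
Qed.

(** * Divisors sorted by their top digit *)

Lemma d2_sum k n : 0 < n < 2 ^ k ->
  d2 n = \sum_(0 <= p < 2 ^ k) `[< dismal_dvd p n >].
Proof.
case/andP=> n0 nk; set P := fun p => `[< dismal_dvd p n >].
have ltP p : dismal_dvd p n -> p < 2 ^ k.
  have [->|p0] := posnP p; first by rewrite expn_gt0.
  case/dismal_dvdP=> q pq; have [j ji /andP[_ qj]] : exists2 j,
      j <= trunc_log 2 n & tbit p j && tbit q (trunc_log 2 n - j).
    by apply/pq; apply: tbit_top; apply: trunc_log_bounds.
  have tp := trunc_log_bounds (isT : 1 < 2) p0.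
  have : tbit n (trunc_log 2 p + (trunc_log 2 n - j)).
    apply/pq; exists (trunc_log 2 p); first exact: leq_addr.
    by rewrite (tbit_top tp) addKn.
  move/(tbit_small nk) => lt; case/andP: tp => _ /leq_trans; apply.
  by rewrite leq_exp2l //; lia.
have -> : d2 n = #|` [fset p in filter P (iota 0 (2 ^ k))]|%fset.
  rewrite /d2; congr (#|` _|%fset); apply/fsetP => p.
  rewrite in_fset_set ?in_fset /=; last exact: finite_dismal_divisors.
  rewrite mem_filter mem_iota /= add0n.
  apply/idP/idP => [|/andP[/asboolP pn _]]; rewrite inE // => pn.
  by rewrite ltP // andbT; apply/asboolP.
rewrite card_fseq undup_id ?filter_uniq ?iota_uniq // size_filter.
by rewrite -sum1_count big_mkcond /= /index_iota subn0.
Qed.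

Lemma sum_dyadic (f : nat -> nat) k : f 0 = 0 ->
  \sum_(0 <= p < 2 ^ k) f p =
  \sum_(0 <= t < k) \sum_(2 ^ t <= p < 2 ^ t.+1) f p.
Proof.
move=> f0; elim: k => [|k IH]; first by rewrite big_nat1 big_nil.
by rewrite big_nat_recr //= -IH -big_cat_nat //= leq_exp2l.
Qed.

Definition d2_at k t :=
  \sum_(2 ^ t <= p < 2 ^ t.+1) `[< dismal_dvd p (2 ^ k - 3) >].

Lemma d2_at_top k : 2 < k -> d2_at k k.-1 = 1.
Proof.
move=> k2; have kk : k.-1.+1 = k by lia.
have N1 : 2 ^ k.-1 <= 2 ^ k - 3 < 2 ^ k.-1.+1.
  have : 2 ^ 2 <= 2 ^ k.-1 by rewrite leq_exp2l //; lia.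
  by rewrite -[k in 2 ^ k - 3]kk !expnS; lia.
rewrite /d2_at (bigD1_seq (2 ^ k - 3)) ?mem_index_iota ?iota_uniq //=.
have kk1 : k.-1 < k by lia.
rewrite asboolT; last by apply/(dvd_m3P k2 kk1 N1); left; rewrite subnn.
rewrite addnC big_seq_cond big1 // => p; rewrite mem_index_iota => /andP[pk ne].
rewrite asboolF // => /(dvd_m3P k2 kk1 pk); rewrite subnn.
by case=> [[_ e]|[]//]; rewrite e eqxx in ne.
Qed.

Lemma d2_at_subtop k : 2 < k -> d2_at k k.-2 = 0.
Proof.
move=> k2; rewrite /d2_at big_seq big1 // => p; rewrite mem_index_iota => pk.
have kk : k.-2 < k by lia.
rewrite asboolF // => /(dvd_m3P k2 kk pk).
have -> : k.-1 - k.-2 = 1 by lia.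
by case=> [[]|[]].
Qed.

Lemma d2_at_bottom k : 2 < k -> d2_at k 0 = 1.
Proof.
move=> k2; rewrite /d2_at big_nat1 asboolT //.
have k0 : 0 < k by lia.
have p1 : 2 ^ 0 <= 1 < 2 ^ 1 by [].
apply/(dvd_m3P k2 k0 p1); right; split=> //; last by move=> i; lia.
by rewrite subn0; lia.
Qed.

(** A divisor ends with the digits 01, after which the automaton is in the
    state [(false, 2)]. *)
Lemma acceptsE m p t : 0 < t -> 2 ^ t <= p < 2 ^ t.+1 ->
  (p %% 4 == 1) && accepts m false 2 t.-1 (p %/ 4) <->
  [/\ tbit p 0, ~~ tbit p 1 &
      forall i, 1 < i <= t.+1 -> tbit p i \/ window m p i].
Proof.
move=> t0 pt; have pT := tbit_top pt.
have p4 : p %% 4 = tbit p 0 + 2 * tbit p 1.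
  rewrite /tbit expn0 divn1 expn1; lia.
have e : 2 + t.-1 = t.+1 by lia.
have e4 : p %/ 4 = p %/ 2 ^ 2 by [].
split=> [/andP[p41]|[p0 p1 pw]].
  have p0 : tbit p 0 by move: p41; rewrite p4; case: tbit => //; case: tbit.
  have p1 : ~~ tbit p 1 by move: p41; rewrite p4 p0; case: tbit.
  rewrite e4 => /acceptsP [] //.
  - by rewrite /= (negbTE p1).
  - by move=> e'; lia.
  rewrite e /= => _ wt pw; split=> // i /andP[i1].
  rewrite leq_eqVlt => /predU1P[->|it]; first by right.
  by apply: pw; rewrite i1.
rewrite p4 p0 (negbTE p1) /= e4; apply/acceptsP => //.
- by rewrite /= (negbTE p1).
- by move=> e'; lia.
rewrite e /=; split=> //.
- case: (pw t.+1) => //; first by rewrite ltnS t0 leqnn.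
  by case/andP: pt => _ pt /(tbit_small pt); rewrite ltnn.
- by move=> j /andP[j1 jt]; apply: pw; rewrite j1 ltnW.
Qed.

Lemma d2_at_mid k t : 0 < t -> t < k.-2 ->
  d2_at k t = accept_count (k.-1 - t) false 2 t.-1.
Proof.
move=> t0 tk; set m := k.-1 - t.
have k2 : 2 < k by lia. have tk' : t < k by lia.
pose f p : nat := (p %% 4 == 1) && accepts m false 2 t.-1 (p %/ 4).
have -> : d2_at k t = \sum_(2 ^ t <= p < 2 ^ t.+1) f p.
  rewrite /d2_at !big_nat; apply: eq_bigr => p pt; congr nat_of_bool.
  apply/asboolP/idP => [/(dvd_m3P k2 tk' pt)|/(acceptsE _ t0 pt) [p0 p1 pw]].
    case=> [[]|[_ p0 p1 pw]]; first lia.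
    exact/acceptsE.
  by apply/(dvd_m3P k2 tk' pt); right; split=> //; lia.
(* The acceptance test already forces the top digit of p to be at t. *)
have -> : \sum_(2 ^ t <= p < 2 ^ t.+1) f p = \sum_(0 <= p < 2 ^ t.+1) f p.
  rewrite [RHS](@big_cat_nat _ _ _ (2 ^ t)) //=; last by rewrite leq_exp2l.
  rewrite [X in X + _]big_nat [X in X + _]big1 // => p /andP[_ pt].
  rewrite /f; case: (t) t0 pt => [|[|n]] //= _ pt; first by rewrite andbF.
  rewrite -/(accepts m false 2 n.+1 _) accepts_small ?andbF //.
  by rewrite ltn_divLR // -(expnD 2 n 2) addn2.
have -> : 2 ^ t.+1 = 4 * 2 ^ t.-1.
  by rewrite -(expnD 2 2) add2n prednK.
rewrite sum_quarter => [|p /negbTE pn]; last by rewrite /f pn.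
rewrite -accept_countE; apply: eq_bigr => q _; rewrite /f.
by rewrite mulnC modnMDl divnMDl // addn0 eqxx.
Qed.

(** For [1 < m], the number of [p] with top digit at [n] that satisfy the
    covering condition of [dvd_m3P]; the case [n = 0] is apart because the
    expansion of 1 is too short to end with 01. *)
Definition term_coef m n := if n is n'.+1 then accept_count m false 2 n' else 1.

Lemma d2_m3 k : 2 < k ->
  d2 (2 ^ k - 3) = 1 + \sum_(0 <= t < k.-2) term_coef (k.-1 - t) t.
Proof.
move=> k2.
have k4 : 2 ^ 2 <= 2 ^ k by rewrite leq_exp2l //; lia.
rewrite (@d2_sum k); last by lia.
rewrite sum_dyadic; last first.
  apply/eqP; rewrite eqb0; apply/negP => /asboolP /dismal_dvdP [q /(_ 0)].
  rewrite tbit_m3 //= => -[/(_ isT)[j _]]; by rewrite tbit_nat0.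
have {1}-> : k = k.-2.+2 by lia.
rewrite !big_nat_recr //= -/(d2_at k k.-2) -/(d2_at k k.-2.+1).
have -> : k.-2.+1 = k.-1 by lia.
rewrite d2_at_top // d2_at_subtop // addn0 addnC; congr (_ + _).
rewrite !big_nat; apply: eq_bigr => -[|t] /= tk.
  by rewrite -/(d2_at k 0) d2_at_bottom.
by rewrite -/(d2_at k t.+1) d2_at_mid.
Qed.

(** * Coefficients and sums of power series *)

Local Open Scope ring_scope.

Lemma fps_coefXM (R : comNzRingType) (f : {fps R}) n :
  (fpsX R * f)`[n] = if n is n'.+1 then f`[n'] else 0.
Proof.
rewrite fps_coefM; case: n => [|n]; first by rewrite big_ord1 /= mul0r.
rewrite !big_ord_recl /= mul0r add0r mul1r subSS subn0 big1 ?addr0 // => i _.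
by rewrite mul0r.
Qed.

Lemma fps_coefXnM (R : comNzRingType) (f : {fps R}) m n :
  (fpsX R ^+ m * f)`[n] = if (n < m)%N then 0 else f`[n - m].
Proof.
elim: m n => [|m IH] n; first by rewrite expr0 mul1r subn0.
by rewrite exprS -mulrA fps_coefXM; case: n => [|n] //; rewrite IH.
Qed.

Lemma fps_coefXn (R : comNzRingType) m n :
  (fpsX R ^+ m)`[n] = (n == m)%:R.
Proof.
rewrite -[_ ^+ m]mulr1 fps_coefXnM fps_coef1 subn_eq0.
by case: ltngtP.
Qed.

Lemma fps_coefMn (R : comNzRingType) (f : {fps R}) a n :
  (f *+ a)`[n] = f`[n] *+ a.
Proof. by elim: a => [|a IH]; rewrite ?mulr0n // !mulrS fps_coefD IH. Qed.

Lemma fps_coef_sum (R : zmodType) (I : Type) (s : seq I) (F : I -> {fps R}) n :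
  (\sum_(i <- s) F i)`[n] = \sum_(i <- s) (F i)`[n].
Proof.
elim: s => [|i s IH]; first by rewrite !big_nil.
by rewrite !big_cons fps_coefD IH.
Qed.

(** A series of terms whose order of vanishing tends to infinity converges,
    and each coefficient of the sum is a finite sum. *)
Lemma fps_sums_to_finite (R : zmodType) m (F : nat -> {fps R}) :
  (forall i n, (m <= i)%N -> (n < i)%N -> (F i)`[n] = 0) ->
  fps_sums_to m F (Fps (fun n => \sum_(m <= i < n.+1) (F i)`[n])).
Proof.
move=> F0 n; exists (maxn m n.+1) => M; rewrite geq_max => /andP[mM nM].
rewrite fps_coef_sum /=; have [mn|nm] := leqP m n.+1.
  rewrite (@big_cat_nat _ _ _ n.+1) //= [X in _ + X]big_nat.
  by rewrite [X in _ + X]big1 ?addr0 // => i /andP[ni _]; apply: F0; lia.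
rewrite [RHS]big_geq 1?ltnW // big_nat big1 // => i /andP[mi _].
by apply: F0 => //; lia.
Qed.

Lemma geometric_fps : (1 - fpsX int)^-1 = Fps (fun=> 1).
Proof.
set g : {fps int} := Fps _.
have e : g * (1 - fpsX int) = 1.
  apply/fpsP => n; rewrite mulrC mulrBl mul1r fps_coefD fps_coefN fps_coefXM.
  by case: n => [|n] /=; rewrite ?subr0 ?subrr.
have u : 1 - fpsX int \is a GRing.unit by rewrite fps_unitE.
by apply: (mulIr u); rewrite mulVr // e.
Qed.

(** * Generating functions of the automaton *)

Definition accept_fps m b d : {fps int} :=
  Fps (fun n => (accept_count m b d n)%:R).

Section Solve.
Variable m : nat.
Hypothesis m1 : (1 < m)%N.
Let z : {fps int} := fpsX int.
Let G := accept_fps m.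

Lemma accept_fpsE b d : G b d =
  (b && (d <= m)%N)%:R +
  z * (G true (if b then 2%N else d.+1)
       + (d <= m)%N%:R * G false (if b then 2%N else d.+1)).
Proof.
rewrite mulr_natl; apply/fpsP => n; rewrite fps_coefD fps_coefXM fps_coefMn.
case: n => [|n] /=; first by rewrite addr0.
by rewrite mul0rn add0r fps_coefMn natrD natrM mulr_natl.
Qed.

Let T := G true 2%N.
Let F := G false.

(** As long as the latest 1 before the last digit is within reach, a word that
    has just read a 1 may forget how far it is: the new 1 will take its place
    after the next step. *)
Lemma accept_fps_true d : (d <= m)%N -> G true d = T.
Proof. by move=> dm; rewrite [LHS]accept_fpsE [RHS]accept_fpsE dm m1. Qed.

(** Out of reach, the word must go on with a second 1. *)
Lemma accept_fps_stale d : (m < d)%N -> G true d = z * T.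
Proof.
move=> dm; rewrite [LHS]accept_fpsE leqNgt dm /= -/T.
by rewrite mul0r addr0 add0r.
Qed.

(** Solves the chain of equations of the states inside a run of zeros, from
    the longest admissible run down: the summand [z * (1 - z ^+ e)] comes from
    runs after which a single 1 suffices, and the other one from the two
    longest runs, after which two are needed. *)
Lemma accept_fps_false e : (e < m)%N ->
  (1 - z) * F (m - e)%N = T * (z * (1 - z ^+ e) + z ^+ e.+2 * (1 - z ^+ 2)).
Proof.
have FE d : F d = z * (G true d.+1 + (d <= m)%N%:R * F d.+1).
  by rewrite [LHS]accept_fpsE /= add0r.
elim: e => [|e IH] em.
  rewrite subn0 FE leqnn accept_fps_stale // FE ltnn accept_fps_stale 1?ltnW //=.
  by rewrite expr0; ring.
rewrite FE leq_subr accept_fps_true; last by lia.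
have -> : (m - e.+1).+1 = (m - e)%N by lia.
rewrite mul1r mulrCA mulrDr IH; last by lia.
rewrite !exprS; ring.
Qed.

Let D := 1 - 2%:R * z + z ^+ m - z ^+ m.+1 + z ^+ (m + 3).

(** The words [1] and [10...] have together the series [z * (1 + z * F 2)],
    which is therefore the rational function of the theorem up to a power of
    [z]. *)
Lemma term_fps_mul : (1 + z * F 2%N) * D = (1 - z) ^+ 2.
Proof.
have hF : (1 - z) * F 2%N = T * (z * (1 - z ^+ (m - 2)) + z ^+ m * (1 - z ^+ 2)).
  have := @accept_fps_false (m - 2) ltac:(lia); rewrite subKn //.
  by have -> : (m - 2).+2 = m by lia.
have hT : T = 1 + z * (T + F 2%N).
  by rewrite [LHS]accept_fpsE m1 /= mul1r.
have hTF : T * (1 - z) = 1 + z * F 2%N.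
  by rewrite mulrBr mulr1 {1}hT; ring.
have yE : z ^+ m = z ^+ 2 * z ^+ (m - 2) by rewrite -exprD subnKC.
have : T * D = 1 - z.
  have : T * (1 - z) * (1 - z) = 1 - z + z * ((1 - z) * F 2%N).
    by rewrite hTF; ring.
  rewrite hF /D addn3 !exprS yE => h.
  apply: (@addIr _ (T * (1 - z) * (1 - z))); rewrite {1}h; ring.
by rewrite -hTF => h; rewrite -[_ * D]mulrA (mulrC _ D) mulrA h expr2.
Qed.
End Solve.

(** * The rational terms and their sum *)

(** The index [l] is the length of the cofactor, so that [m = l.-1]. *)
Definition rat_term l : {fps int} :=
    ((1 - fpsX int) ^+ 2 * fpsX int ^+ l)
      / (1 - 2%:R * fpsX int + fpsX int ^+ (l - 1) - fpsX int ^+ l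
         + fpsX int ^+ (l + 2)).

Lemma rat_term_coef l n : (2 < l)%N ->
  (rat_term l)`[n] = if (n < l)%N then 0 else (term_coef l.-1 (n - l))%:R.
Proof.
move=> l2; have l1 : (1 < l.-1)%N by lia.
have -> : rat_term l = fpsX int ^+ l * (1 + fpsX int * accept_fps l.-1 false 2%N).
  rewrite /rat_term -(term_fps_mul l1) subn1 prednK 1?ltnW 1?ltnW //.
  have -> : (l.-1 + 3 = l + 2)%N by lia.
  set D := (X in _ / X); rewrite [X in X / _]mulrC mulrA mulrK //.
  rewrite fps_unitE /D mulr_natl.
  rewrite !fps_coefD !fps_coefN !fps_coefXn fps_coefMn.
  by case: (l) l2 => [|[|[|l']]].
rewrite fps_coefXnM; case: ifP => // _; rewrite fps_coefD fps_coefXM.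
by case: (n - l)%N => [|n'] //=; rewrite add0r.
Qed.

(** A divisor with top digit at [t] of a number of length [n] has a cofactor of
    length [l = n - t]; this is the change of variable. *)
Lemma rat_sum_coef n : (2 < n)%N ->
  \sum_(3 <= l < n.+1) (rat_term l)`[n] =
  (\sum_(0 <= t < n.-2) term_coef (n.-1 - t) t)%N%:R.
Proof.
move=> n2; rewrite natr_sum big_nat_rev (big_addn 0 _ 3).
have -> : (n.+1 - 3 = n.-2)%N by lia.
rewrite !big_nat; apply: eq_bigr => t /andP[_ tn].
rewrite rat_term_coef; last by lia.
have -> : (3 + n.+1 - (t + 3).+1 = n - t)%N by lia.
rewrite ltnNge leq_subr /= subKn; last by lia.
by have -> : ((n - t).-1 = n.-1 - t)%N by lia.
Qed.

Lemma rat_sums_to : fps_sums_to 3 rat_term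
  (Fps (fun n => \sum_(3 <= l < n.+1) (rat_term l)`[n])).
Proof.
by apply: fps_sums_to_finite => l n l3 nl; rewrite rat_term_coef // nl.
Qed.

Theorem theorem14 :
  let z : {fps int} := fpsX int in
  let divisor_term (k : nat) : {fps int} := (d2 (2 ^ k - 3)%N)%:R * z ^+ k in
  let rational_term (l : nat) : {fps int} :=
    ((1 - z) ^+ 2 * z ^+ l)
      / (1 - 2%:R * z + z ^+ (l - 1) - z ^+ l + z ^+ (l + 2)) in
  [/\ fps_summable 3 divisor_term,
      fps_summable 3 rational_term,
      \fps_sum_(3 <= k) divisor_term k
        = z ^+ 3 / (1 - z) + \fps_sum_(3 <= l) rational_term l
    & exists r : {fps int},
        z ^+ 3 / (1 - z) + \fps_sum_(3 <= l) rational_term l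
        = 2%:R * z ^+ 3 + 2%:R * z ^+ 4 + 2%:R * z ^+ 5 + 4%:R * z ^+ 6
          + 6%:R * z ^+ 7 + 10%:R * z ^+ 8 + z ^+ 9 * r].
Proof.
move=> z divisor_term rational_term.
have dcoef k n : (divisor_term k)`[n] =
    if n == k then (d2 (2 ^ k - 3)%N)%:R else 0.
  rewrite /divisor_term mulr_natl fps_coefMn fps_coefXn.
  by case: eqP => //; rewrite mul0rn.
have dsum : fps_sums_to 3 divisor_term
    (Fps (fun n => \sum_(3 <= k < n.+1) (divisor_term k)`[n])).
  by apply: fps_sums_to_finite => k n _ nk; rewrite dcoef ltn_eqF.
have rsum : fps_sums_to 3 rational_term _ := rat_sums_to.
have rhs n : (z ^+ 3 / (1 - z) + \fps_sum_(3 <= l) rational_term l)`[n] =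
    if (2 < n)%N then
      (1 + \sum_(0 <= t < n.-2) term_coef (n.-1 - t) t)%N%:R else 0.
  rewrite (fps_sumE rsum) fps_coefD geometric_fps fps_coefXnM.
  have [n2|n2] := ltnP n 3; last by rewrite natrD -rat_sum_coef.
  by rewrite add0r; apply: big_geq.
split; [by eexists; exact: dsum | by eexists; exact: rsum | |].
  rewrite (fps_sumE dsum); apply/fpsP => n; rewrite rhs [LHS]/fps_coef.
  case: ifP => n2; last by rewrite big_geq //; lia.
  rewrite big_nat_recr // dcoef eqxx d2_m3 // big_nat.
  rewrite big1 => [|k kn]; first by rewrite /= add0r.
  by rewrite dcoef gtn_eqF //; lia.
move: (z ^+ 3 / (1 - z) + _) rhs => S rhs.
exists (Fps (fun n => S`[(n + 9)%N])).
apply/fpsP => n.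
rewrite 6!fps_coefD fps_coefXnM !mulr_natl !fps_coefMn !fps_coefXn.
have [n9|n9] := ltnP n 9; last first.
  by rewrite /= subnK // !gtn_eqF; lia.
(* The coefficients below z ^+ 9 are computed with [accept_count]. *)
by rewrite rhs; do 9?[case: n n9 => [|n] n9; first by rewrite /= ?unlock].
Qed.
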